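(* Let $m$ be an odd positive integer, let $V$ be a vector space of dimension $m$ over $\mathbb{F}_2$, and let $f: V \to V$ be a function with $f(0)=0$. If the binary code $P_f$ has minimum distance $5$, then $f$ is crooked.
   Context: Let $V = V(m,2)$ be a vector space of dimension $m$ over $\mathbb{F}_2$ with $m$ odd, and let $V^* = V \setminus \{0\}$. Crooked: a function $f: V \to V$ is crooked if the following three conditions hold: (1) $f(0)=0$; (2) $f(x)+f(y)+f(z) \neq f(x+y+z)$ for all distinct $x,y,z \in V$ (pairwise distinct); (3) $f(x)+f(y)+f(z) \neq f(x+a)+f(y+a)+f(z+a)$ for all $x,y,z \in V$ (not necessarily distinct) and all $a \in V$ with $a \neq 0$. The code $P_f$: for $f: V \to V$ with $f(0)=0$, $P_f$ is the (in general nonlinear) binary code of length $(2^m-1)+2^m$, with coordinates indexed by the disjoint union of $V^*$ and $V$, whose codewords are the characteristic vectors of the pairs $(S,T)$ with $S \subseteq V^*$ and $T \subseteq V$ such that (i) $|T|$ is even; (ii) $\sum_{r \in S} r = \sum_{r \in T} r$; (iii) $f\big(\sum_{r \in S} r\big) = \sum_{r \in S} f(r) + \sum_{r \in T} f(r)$. Empty sums are $0$, and $S$ and $T$ may be empty. The minimum distance is the minimum Hamming distance between two distinct codewords; the Hamming distance between the codewords of $(S,T)$ and $(S',T')$ is $|S \oplus S'| + |T \oplus T'|$, where $\oplus$ denotes symmetric difference. *)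

(* Defs.v *)
From HB Require Import structures.
From mathcomp Require Import all_boot all_order all_algebra all_field.

Set Implicit Arguments.
Unset Strict Implicit.
Unset Printing Implicit Defensive.

Import GRing.Theory.
Local Open Scope ring_scope.

Definition crooked (V : zmodType) (f : V -> V) : Prop :=
  [/\ f 0 = 0,
      forall x y z : V, x != y -> x != z -> y != z ->
        f x + f y + f z != f (x + y + z)
    & forall x y z a : V, a != 0 ->
        f x + f y + f z != f (x + a) + f (y + a) + f (z + a)].

Definition hamming_dist (I : finType) (u v : {ffun I -> 'F_2}) : nat :=
  #|[set i | u i != v i]|.

(* The minimum is attained, so a code with fewer than two words has no minimum
   distance at all. *)
Definition has_min_dist (I : finType) (C : {set {ffun I -> 'F_2}}) (d : nat) :
    Prop :=
  (exists u v, [/\ u \in C, v \in C, u != v & hamming_dist u v = d]) /\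
  (forall u v, u \in C -> v \in C -> u != v -> (d <= hamming_dist u v)%N).

Section Code.

Variable V : vectType 'F_2.

(* An abstract [vectType] over a finite field carries no [finType] structure;
   [finvect_type V] is V itself, equipped with one; the casts [(_ : V)]
   below make the sums use the operations of V. *)
Local Notation W := (finvect_type V).

Definition nonzero : finType := {x : W | x != 0}.

Definition coord : finType := (nonzero + W)%type.

Definition char_vec (S : {set nonzero}) (T : {set W}) : {ffun coord -> 'F_2} :=
  [ffun i : coord =>
     (match i with inl r => r \in S | inr r => r \in T end)%:R].

Definition in_P (f : V -> V) (S : {set nonzero}) (T : {set W}) : bool :=
  [&& ~~ odd #|T|,
      \sum_(r in S) (val r : V) == \sum_(r in T) (r : V)
    & f (\sum_(r in S) (val r : V)) ==
        \sum_(r in S) f (val r) + \sum_(r in T) f r].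

Definition P_code (f : V -> V) : {set {ffun coord -> 'F_2}} :=
  [set char_vec p.1 p.2 |
     p in [pred p : {set nonzero} * {set W} | in_P f p.1 p.2]].

End Code.

(* Main.v *)
Require Import Defs.
From HB Require Import structures.
From mathcomp Require Import all_boot all_order all_algebra all_field.
From mathcomp Require Import zify.

Set Implicit Arguments.
Unset Strict Implicit.
Unset Printing Implicit Defensive.

Import GRing.Theory.
Local Open Scope ring_scope.

(** Everything rests on moves between codewords. Adding (B, E), with E even and
    B, E of equal sum, to a codeword whose S-part sums to s gives a codeword
    again when f(s + sum B) + f(s) is the sum of f over B and E; the distance
    travelled is at most |B| + |E|, so such a move of size at most 4 contradicts
    minimum distance 5 ([min_dist_move]).

    A failure f(x) + f(y) + f(z) = f(x + y + z) makes (empty, {x,y,z,x+y+z}) such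
    a move from the zero codeword: hence f is almost perfect nonlinear
    ([apn_of_min_dist5]).
    A failure of the third condition at x, y, z, a reads
      f(x + a) + f(x) = f(y) + f(y + a) + f(z) + f(z + a),
    so B = {y, y+a}, E = {z, z+a} is such a move from any codeword whose S-part
    sums to x.

    The real content is that the latter codeword exists: with S = {x} one needs
    an even T with sum x on which the values of f sum to 0
    ([even_set_with_sums]). As 0 can be toggled in T to fix the parity, it is
    enough that the graph of f spans V x V ([graph_spans]). Otherwise some
    functional (alpha, beta) vanishes on the graph, that is beta o f = alpha is
    linear, with beta nonzero. By the APN property the derivative
    x |-> f(x) + f(x + a) is at most two-to-one, and its values lie in the affine
    hyperplane beta = alpha(a), of size |V|/2; so it is exactly two-to-one onto
    that hyperplane. A functional gamma which is not constant on the kernel of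
    beta splits each such hyperplane evenly, so gamma o f has balanced
    derivatives, i.e. is bent ([apn_linear_component_bent]). Counting pairs
    then shows that |V| = 2^m is a perfect square ([card_square_of_bent]),
    contrary to m being odd. This needs m > 1; for m = 1 the length of the code
    is 3, which excludes two words at distance 5. *)

(** * Characteristic two *)

Lemma F2_eq1 (c : 'F_2) : (c == 1) = (c != 0).
Proof. by case: c => [[|[|n]] lt_n2]. Qed.

Lemma pchar_F2 : 2%N \in [pchar 'F_2].
Proof. exact: (@pchar_Fp 2). Qed.

Lemma F2_add_self (V : lmodType 'F_2) (x : V) : x + x = 0.
Proof. by rewrite -mulr2n -scaler_nat (pcharf0 pchar_F2) scale0r. Qed.

Lemma F2_oppr (V : lmodType 'F_2) (x : V) : - x = x.
Proof. by apply/esym/eqP; rewrite -addr_eq0 F2_add_self. Qed.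

Lemma F2_addr_eq0 (V : lmodType 'F_2) (x y : V) : (x + y == 0) = (x == y).
Proof. by rewrite addr_eq0 F2_oppr. Qed.

Lemma F2_add_cancel (V : lmodType 'F_2) (x a : V) : x + (x + a) = a.
Proof. by rewrite addrA F2_add_self add0r. Qed.

Lemma F2_card_split (T : finType) (chi : T -> 'F_2) (P : pred T) :
  #|P| = (#|[pred x | P x && (chi x == 0)]%R| +
          #|[pred x | P x && (chi x == 1)]%R|)%N.
Proof.
rewrite -(cardID [pred x | chi x == 0] P).
by congr (_ + _)%N; apply: eq_card => x; rewrite !inE ?F2_eq1 andbC.
Qed.

Lemma F2_cardT_split (T : finType) (chi : T -> 'F_2) :
  #|T| = (#|[pred x | chi x == 0]%R| + #|[pred x | chi x == 1]%R|)%N.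
Proof. exact: (F2_card_split chi predT). Qed.

Lemma ne_translate (U : zmodType) (x a : U) : a != 0 -> x != x + a.
Proof. by move=> a0; rewrite -subr_eq0 opprD addNKr oppr_eq0. Qed.

Lemma card_translate (U : finZmodType) (P : pred U) (t : U) :
  #|[pred x | P (x + t)]| = #|P|.
Proof.
rewrite -!sum1_card [RHS](reindex_inj (addIr t)).
by apply: eq_bigl => x; rewrite !inE.
Qed.

(** * Bent functions and APN functions *)

(** Write n1, n0 for the numbers of points where h holds and fails. The ordered
    pairs (x, y) with h x != h y number 2 n1 n0; sorted by the difference
    y - x they number (q - 1) q / 2, where q = n1 + n0 = #|U|. Hence
    q = q^2 - 4 n1 n0 = (n1 - n0)^2. *)
Lemma card_square_of_bent (U : finZmodType) (h : pred U) :
    (forall a, a != 0 -> (2 * #|[pred x | h x != h (x + a)%R]|)%N = #|U|) ->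
  exists d, #|U| = (d ^ 2)%N.
Proof.
move=> bal; pose n1 := #|[pred x | h x]|; pose n0 := #|[pred x | ~~ h x]|.
have sumq : (n1 + n0)%N = #|U| by rewrite -(cardC [pred x | h x]).
have pairs : (\sum_x \sum_y (h x != h y) = 2 * (n1 * n0))%N.
  have row x : (\sum_y (h x != h y) = if h x then n0 else n1)%N.
    rewrite /n0 /n1 -!sum1_card.
    by case: (h x); rewrite [RHS]big_mkcond /=; apply: eq_bigr => y _;
      rewrite inE; case: (h y).
  rewrite (eq_bigr _ (fun x _ => row x)) (bigID h) /=.
  rewrite (eq_bigr (fun=> n0)) => [|x ->] //.
  rewrite [X in (_ + X)%N](eq_bigr (fun=> n1)) => [|x /negPf->] //.
  by rewrite !sum_nat_const -/n1 -/n0; nia.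
have shifts : (2 * \sum_x \sum_y (h x != h y) = #|U|.-1 * #|U|)%N.
  under eq_bigr => x _ do rewrite (reindex_inj (addrI x)).
  rewrite exchange_big (bigD1 0) //= big1 => [|x _]; last by rewrite addr0 eqxx.
  rewrite add0n big_distrr /= (eq_bigr (fun=> #|U|)) => [|a /bal <-].
    by rewrite sum_nat_const; congr (_ * _)%N; rewrite (cardC1 (0 : U)).
  by rewrite -sum1_card [in RHS]big_mkcond; congr (2 * _)%N.
exists (`|(n1%:Z - n0%:Z)%R|)%N.
have := sqrn_dist n1 n0; have : (0 < #|U|)%N by apply/card_gt0P; exists 0.
by nia.
Qed.

(** Over a space of characteristic two this is almost perfect nonlinearity:
    see [apn_fiber]. *)
Definition apn (U : zmodType) (f : U -> U) : Prop :=
  forall x y z, x != y -> x != z -> y != z -> f x + f y + f z != f (x + y + z).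

Section LinearComponent.

Variables (U : finZmodType) (f : U -> U) (alpha beta gamma : U -> 'F_2).
Hypothesis addUU : forall x : U, x + x = 0.
Hypothesis f_apn : apn f.
Hypothesis betaD : {morph beta : x y / x + y}.
Hypothesis gammaD : {morph gamma : x y / x + y}.
Hypothesis beta_f : forall x, beta (f x) = alpha x.
Hypothesis alphaD : {morph alpha : x y / x + y}.

(** If x and y have the same derivative in direction a, then
    f(x) + f(x + a) + f(y) = f(x + (x + a) + y): so y is x or x + a. *)
Lemma apn_fiber (a : U) (v : U) :
  a != 0 -> (#|[pred x | f x + f (x + a) == v]%R| <= 2)%N.
Proof.
move=> a0; case: (pickP [pred x | f x + f (x + a) == v]) => [x /= /eqP gx|];
  last by move/eq_card0=> ->.
apply: leq_trans (subset_leq_card _) (card_size [:: x; x + a]).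
apply/subsetP=> y; rewrite !inE => /eqP gy; apply/negPn/negP.
rewrite negb_or => /andP[yx yxa].
rewrite eq_sym in yx; rewrite eq_sym in yxa.
have := f_apn (ne_translate x a0) yx yxa.
have -> : x + (x + a) + y = y + a by rewrite addrA addUU add0r addrC.
by rewrite gx -gy addrAC addUU add0r eqxx.
Qed.

Variables (b k : U).
Hypothesis beta_b : beta b = 1.
Hypothesis beta_k : beta k = 0.
Hypothesis gamma_k : gamma k = 1.

(** Let G c collect the points whose derivative has gamma-value c, and H c the
    points of the hyperplane beta = alpha a with gamma-value c. The derivative
    maps G c into H c, at most two-to-one; translation by k exchanges H 0 and
    H 1, so each has size #|U| / 4 and neither G c exceeds #|U| / 2. As G 0 and
    G 1 partition U, both bounds are attained. *)
Lemma apn_linear_component_bent (a : U) : a != 0 ->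
  (2 * #|[pred x | (gamma (f x) == 1) != (gamma (f (x + a)) == 1)]%R|)%N = #|U|.
Proof.
move=> a0; pose g x := f x + f (x + a).
pose G c := [pred x | gamma (g x) == c].
pose H c := [pred v | (beta v == alpha a) && (gamma v == c)].
have GH c : (#|G c| <= 2 * #|H c|)%N.
  rewrite -sum1_card (partition_big g [in H c]) /= => [|x]; last first.
    rewrite !inE => ->; rewrite andbT betaD !beta_f alphaD addrA.
    by rewrite (addrr_pchar2 pchar_F2) add0r.
  rewrite mulnC -sum_nat_const; apply: leq_sum => v _.
  apply: leq_trans (apn_fiber v a0); rewrite sum1_card.
  by apply/subset_leq_card/subsetP=> x; rewrite !inE => /andP[].
have H01 : #|H 0| = #|H 1|.
  rewrite -(card_translate (H 1) k); apply: eq_card => v; rewrite !inE.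
  rewrite betaD beta_k addr0 gammaD gamma_k F2_eq1.
  by rewrite -[1](oppr_pchar2 pchar_F2) subr_eq0 F2_eq1 negbK.
have Hhalf : (2 * (#|H 0%R| + #|H 1%R|) = #|U|)%N.
  rewrite -(F2_card_split gamma [pred v | beta v == alpha a]).
  rewrite (F2_cardT_split (fun v => beta v + alpha a)) mul2n -addnn.
  (* Translation by b exchanges the two cosets of the kernel of beta. *)
  congr (_ + _)%N; last rewrite -[RHS](card_translate _ b).
    by apply: eq_card => v; rewrite !inE addr_eq0 (oppr_pchar2 pchar_F2).
  apply: eq_card => v; rewrite !inE betaD beta_b.
  by case: (beta v) (alpha a) => [[|[|?]] ?] [[|[|?]] ?].
have Gsum : (#|G 0%R| + #|G 1%R| = #|U|)%N.
  by rewrite (F2_cardT_split (gamma \o g)).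
have := GH 0; have := GH 1.
suff -> : #|[pred x | (gamma (f x) == 1) != (gamma (f (x + a)) == 1)]| =
          #|G 1| by lia.
apply: eq_card => x; rewrite !inE gammaD.
by case: (gamma (f x)) (gamma (f (x + a))) => [[|[|?]] ?] [[|[|?]] ?].
Qed.

End LinearComponent.

(** * Linear functionals *)

Lemma separating_functional (K : fieldType) (vT : vectType K)
    (L : {vspace vT}) (u : vT) :
  u \notin L ->
  exists2 phi : {scalar vT}, (forall v, v \in L -> phi v = 0) & phi u != 0.
Proof.
move=> uL; pose w := u - projv L u.
have w0 : w != 0 by apply: contraNneq uL => /subr0_eq ->; exact: memv_proj.
case: (pickP (fun i => coord (vbasis {:vT}) i w != 0)) => [i ci|c0]; last first.
  case/eqP: w0; rewrite (coord_vbasis (memvf w)) big1 // => i _.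
  by move/negbFE/eqP: (c0 i) => ->; rewrite scale0r.
exists (coord (vbasis {:vT}) i \o (\1 - projv L)%VF) => [v vL|] /=.
  by rewrite !lfunE /= !lfunE /= projv_id // subrr linear0.
by rewrite !lfunE /= !lfunE.
Qed.

Lemma F2_kernel_nontrivial (U : finZmodType) (beta : U -> 'F_2) :
  (2 < #|U|)%N -> {morph beta : x y / x + y} ->
  exists2 k, k != 0 & beta k = 0.
Proof.
move=> U2 betaD.
have pick_out (s : seq U) : (size s <= 2)%N -> exists x, x \notin s.
  move=> s2; case: (pickP [predC s]) => [x xs|s0]; first by exists x.
  have sT : U \subset s by apply/subsetP=> x _; have /negbFE := s0 x.
  have := leq_trans U2 (leq_trans (subset_leq_card sT) (card_size s)).
  by rewrite ltnNge s2.
have [x] := pick_out [:: 0] isT; rewrite inE => x0.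
have [y] := pick_out [:: 0; x] isT; rewrite !inE negb_or => /andP[y0 yx].
case: (eqVneq (beta x) 0) => [|]; first by exists x.
case: (eqVneq (beta y) 0) => [|]; first by exists y.
rewrite -!F2_eq1 => /eqP by1 /eqP bx1.
have bN : beta (y - x) = 0.
  by apply: (addIr (beta x)); rewrite -betaD subrK add0r by1 bx1.
by exists (y - x); rewrite ?subr_eq0.
Qed.

(** * The graph of an APN function *)

Section Graph.

Variables (V : vectType 'F_2) (f : V -> V).
Local Notation W := (finvect_type V).
Hypothesis dim_odd : odd (\dim {:V}).
Hypothesis dim_gt1 : (1 < \dim {:V})%N.
Hypothesis f_apn : apn f.
Hypothesis f0 : f 0 = 0.

Lemma card_finvect : #|W| = (2 ^ \dim {:V})%N.
Proof.
rewrite -(@card_vspacef 'F_2 W (Vector.on W)) (@card_vspace 'F_2 W).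
by rewrite card_Fp.
Qed.

Lemma card_finvect_not_square d : #|W| != (d ^ 2)%N.
Proof.
apply/eqP; rewrite card_finvect => /(congr1 (logn 2)).
rewrite lognX lognX logn_prime // muln1 => e.
by move: dim_odd; rewrite e mul2n odd_double.
Qed.

(** A functional phi vanishing on the graph splits as (alpha, beta) with
    beta o f = alpha; it is nonzero, and so is beta, since beta = 0 would force
    alpha = 0. Any k <> 0 in the kernel of beta, with any gamma not vanishing at
    k, then yields a bent function on V. *)
Lemma graph_spans : (\sum_(x : W) <[(x : V, f x)]>)%VS = {:(V * V)%type}%VS.
Proof.
apply/eqP; rewrite eqEsubv subvf /=; apply/subvP=> u _; apply/negPn/negP.
case/separating_functional=> phi phi0 phiu.
pose alpha (x : W) := phi (x : V, 0); pose beta (v : W) := phi (0, v : V).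
have phiE (p : V * V) : phi p = alpha p.1 + beta p.2.
  rewrite /alpha /beta -raddfD; congr (phi _); case: p => x v /=.
  by congr pair; rewrite /= ?addr0 ?add0r.
have alphaD : {morph alpha : x y / x + y}.
  move=> x y; rewrite /alpha -raddfD; congr (phi _).
  by congr pair; rewrite /= addr0.
have betaD : {morph beta : x y / x + y}.
  move=> x y; rewrite /beta -raddfD; congr (phi _).
  by congr pair; rewrite /= addr0.
have beta_f (x : W) : beta (f x) = alpha x.
  apply/esym/eqP; rewrite -[beta _](oppr_pchar2 pchar_F2) -addr_eq0.
  rewrite -(phiE (x : V, f x)) phi0 //.
  by rewrite (subvP (sumv_sup x _ (subvv _))) ?memv_line.
have [b beta_b] : exists b, beta b = 1.
  case: (eqVneq (beta u.2) 0) => [b2|]; last first.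
    by rewrite -F2_eq1 => /eqP; exists u.2.
  exists (f u.1); rewrite beta_f; apply/eqP; rewrite F2_eq1.
  by move: phiu; rewrite phiE b2 addr0.
have [|k k0 beta_k] := F2_kernel_nontrivial _ betaD.
  by rewrite card_finvect (@ltn_exp2l 2 1).
have [|gamma _] := @separating_functional _ V 0%VS k; first by rewrite memv0.
rewrite -F2_eq1 => /eqP gamma_k.
have [d] : exists d, #|W| = (d ^ 2)%N; last first.
  by apply/eqP/card_finvect_not_square.
apply: (card_square_of_bent (U := W) (h := fun x => gamma (f x) == 1)) => a a0.
exact: (@apn_linear_component_bent W f alpha beta gamma (@F2_add_self V) f_apn
          betaD (raddfD gamma) beta_f alphaD b k).
Qed.

Lemma even_set_with_sums (s v : V) :
  exists T : {set W},
    [/\ ~~ odd #|T|, \sum_(r in T) (r : V) = s & \sum_(r in T) f r = v].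
Proof.
have : (s, v) \in (\sum_(x : W) <[(x : V, f x)]>)%VS.
  by rewrite graph_spans memvf.
case/memv_sumP=> w wP sv; pose T := [set x : W | w x != 0].
have wE x : w x = if x \in T then (x : V, f x) else 0.
  rewrite inE; case: eqP => //= w0; have /vlineP[c cw] := wP x isT.
  move/eqP: w0; rewrite cw scaler_eq0 negb_or -F2_eq1 => /andP[/eqP-> _].
  by rewrite scale1r.
have sumT : \sum_(x in T) (x : V, f x) = (s, v).
  by rewrite sv big_mkcond; apply: eq_bigr => x _; rewrite wE.
have sum1T : \sum_(r in T) (r : V) = s.
  by rewrite -[RHS]/((s, v).1) -sumT raddf_sum.
have sum2T : \sum_(r in T) f r = v.
  by rewrite -[RHS]/((s, v).2) -sumT raddf_sum.
case oddT: (odd #|T|); last by exists T; rewrite oddT.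
(* The graph contains (0, 0), so 0 can enter or leave T at will. *)
case: (boolP ((0 : W) \in T)) => T0.
  exists (T :\ (0 : W)); move: sum1T sum2T oddT.
  rewrite !(big_setD1 (0 : W) T0) /= f0 !add0r (cardsD1 (0 : W)) T0 /=.
  by split.
exists ((0 : W) |: T); rewrite !big_setU1 //= f0 !add0r cardsU1 T0 /= oddT.
by split.
Qed.

End Graph.

(** * Moves between codewords *)

Section SymmetricDifference.

Variables (T : finType) (V : lmodType 'F_2).

Definition symdiff (A B : {set T}) := [set i | (i \in A) (+) (i \in B)].

Lemma sum_symdiff (F : T -> V) (A B : {set T}) :
  \sum_(i in symdiff A B) F i = \sum_(i in A) F i + \sum_(i in B) F i.
Proof.
rewrite !(big_mkcond (fun i => i \in _)) -big_split; apply: eq_bigr => i _ /=.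
rewrite inE; case: (i \in A) (i \in B) => [] [] /=;
  by rewrite ?addr0 ?add0r ?F2_add_self.
Qed.

Lemma odd_card_symdiff (A B : {set T}) :
  odd #|symdiff A B| = odd #|A| (+) odd #|B|.
Proof.
have : (#|symdiff A B| + 2 * #|A :&: B| = #|A| + #|B|)%N.
  rewrite -!sum1_card !(big_mkcond (fun i => i \in _)) big_distrr -!big_split /=.
  by apply: eq_bigr => i _; rewrite !inE; case: (i \in A) (i \in B) => [] [].
by move=> /(congr1 odd); rewrite mul2n !oddD odd_double addbF.
Qed.

End SymmetricDifference.

Section Moves.

Variables (V : vectType 'F_2) (f : V -> V).
Local Notation W := (finvect_type V).
Hypothesis f0 : f 0 = 0.

(** Since f 0 = 0, deleting 0 from a set changes none of the sums in the
    definition of the code: subsets of V can thus stand for their S-parts, and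
    no case distinction on vanishing points arises. *)
Definition punctured (A : {set W}) : {set nonzero V} := [set r | val r \in A].

Lemma sum_punctured (F : V -> V) (A : {set W}) : F 0 = 0 ->
  \sum_(r in punctured A) F (val r) = \sum_(r in A) F r.
Proof.
move=> F0; rewrite [RHS](bigID (fun r : W => r != 0)) /=.
rewrite [X in _ + X]big1 ?addr0 => [|i /andP[_ /negPn/eqP->] //].
rewrite (reindex_omap (val : nonzero V -> W) insub) /=; last first.
  by move=> i /andP[_ i0]; rewrite insubT.
by apply: eq_bigl => r; rewrite !inE valK eqxx (valP r) !andbT.
Qed.

Lemma card_punctured (A : {set W}) : (#|punctured A| <= #|A|)%N.
Proof.
rewrite -(card_imset _ val_inj); apply/subset_leq_card/subsetP=> x.
by case/imsetP=> r; rewrite inE => rA ->.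
Qed.

Lemma symdiff_punctured (A B : {set W}) :
  symdiff (punctured A) (punctured B) = punctured (symdiff A B).
Proof. by apply/setP=> r; rewrite !inE. Qed.

Lemma in_P_punctured (A T : {set W}) :
  in_P f (punctured A) T =
  [&& ~~ odd #|T|, \sum_(r in A) (r : V) == \sum_(r in T) (r : V)
    & f (\sum_(r in A) (r : V)) == \sum_(r in A) f r + \sum_(r in T) f r].
Proof. by rewrite /in_P (sum_punctured (F := id)) // sum_punctured. Qed.

Lemma hamming_dist_char_vec (S D : {set nonzero V}) (T E : {set W}) :
  hamming_dist (char_vec S T) (char_vec (symdiff S D) (symdiff T E)) =
  (#|D| + #|E|)%N.
Proof.
have nat_F2 (b c : bool) : (b%:R != c%:R :> 'F_2) = b (+) c by case: b; case: c.
rewrite /hamming_dist -!sum1_card big_mkcond big_sumType /=.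
rewrite !(big_mkcond (fun i => i \in _)).
by congr (_ + _)%N; apply: eq_bigr => i _; rewrite !inE !ffunE nat_F2 !inE;
  case: (i \in _) (i \in _) => [] [].
Qed.

(** The conditions on B and E say exactly that adding them to the codeword
    (punctured A, T) gives a codeword; as E is nonempty, it is a different one,
    even if B is reduced to 0. *)
Lemma min_dist_move d (A B T E : {set W}) (s := \sum_(r in A) (r : V))
    (t := \sum_(r in B) (r : V)) :
    has_min_dist (P_code f) d -> in_P f (punctured A) T ->
    ~~ odd #|E| -> E != set0 -> t = \sum_(r in E) (r : V) ->
    f (s + t) + f s = \sum_(r in B) f r + \sum_(r in E) f r ->
  (d <= #|B| + #|E|)%N.
Proof.
rewrite /s /t => {s t} [[_ min_d]] AT evenE E0 sumBE fBE.
have code S1 T1 : in_P f S1 T1 -> char_vec S1 T1 \in P_code f.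
  by move=> c; apply/imsetP; exists (S1, T1).
have AT' : in_P f (symdiff (punctured A) (punctured B)) (symdiff T E).
  move: AT; rewrite symdiff_punctured !in_P_punctured !sum_symdiff.
  rewrite odd_card_symdiff (negPf evenE) addbF.
  case/and3P=> -> /eqP sAT /eqP fAT /=.
  rewrite addrACA -fAT -fBE addrC -addrA F2_add_self addr0 -sAT sumBE eqxx /=.
  exact: eqxx.
have hd := hamming_dist_char_vec (punctured A) (punctured B) T E.
apply: (leq_trans (n := (#|punctured B| + #|E|)%N)); last first.
  by rewrite leq_add2r card_punctured.
rewrite -hd; apply: min_d; [exact: code | exact: code |].
apply: contraNneq E0 => same; move: hd; rewrite -same /hamming_dist.
under eq_finset => i do rewrite eqxx.
by rewrite cards0 => /esym/eqP; rewrite addn_eq0 !cards_eq0 => /andP[].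
Qed.

Lemma sum_set2 (F : V -> V) (x y : W) :
  x != y -> \sum_(r in [set x; y]) F r = F x + F y.
Proof. by move=> xy; rewrite big_setU1 ?inE // big_set1. Qed.

(** The four points x, y, z, x + y + z sum to 0; if their values under f do so
    too, they are the T-part of a codeword of weight 4. *)
Lemma apn_of_min_dist5 : has_min_dist (P_code f) 5 -> apn f.
Proof.
move=> d5; suff apnW (x y z : W) : x != y -> x != z -> y != z ->
    f x + f y + f z != f (x + y + z) by exact: apnW.
move=> xy xz yz; apply/eqP=> fxyz; pose w : W := x + y + z.
have xw : x != w by rewrite -F2_addr_eq0 /w -!addrA F2_add_cancel F2_addr_eq0.
have yw : y != w.
  by rewrite -F2_addr_eq0 /w -addrA addrCA F2_add_cancel F2_addr_eq0.
have zw : z != w.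
  by rewrite -F2_addr_eq0 /w addrC -addrA F2_add_self addr0 F2_addr_eq0.
pose E : {set W} := x |: (y |: [set z; w]).
have xE : x \notin y |: [set z; w] by rewrite !inE !negb_or xy xz xw.
have yE : y \notin [set z; w] by rewrite !inE !negb_or yz yw.
have sumE (F : V -> V) : \sum_(r in E) F r = F x + (F y + (F z + F w)).
  by rewrite big_setU1 //= big_setU1 //= sum_set2.
have cardE : #|E| = 4%N by rewrite /E !cardsU1 xE yE cards1 inE zw.
have := min_dist_move (A := set0) (B := set0) (T := set0) (E := E).
move=> /(_ 5 d5); rewrite in_P_punctured -!cards_eq0 cards0 cardE !big_set0.
have -> : \sum_(r in E) (r : V) = 0.
  by rewrite (sumE id) 2!addrA; exact: (F2_add_self (x + y + z)).
rewrite sumE !addr0 f0 addr0 !eqxx add0r !addrA fxyz.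
rewrite (F2_add_self (f (x + y + z))).
by move/(_ isT isT isT erefl erefl).
Qed.

End Moves.

Lemma has_min_dist_le_length (I : finType) (C : {set {ffun I -> 'F_2}}) d :
  has_min_dist C d -> (d <= #|I|)%N.
Proof. by case=> [[u [v [_ _ _ <-]]]] _; exact: max_card. Qed.

Theorem theorem3 (m : nat) (V : vectType 'F_2) (f : V -> V)
  (m_odd : odd m) (dimV : \dim {:V} = m) (f0 : f 0 = 0)
  (d5 : has_min_dist (P_code f) 5) :
  crooked f.
Proof.
have f_apn := apn_of_min_dist5 f0 d5.
split=> // x y z a a0; apply/eqP=> fxyz.
have dim_gt1 : (1 < \dim {:V})%N.
  rewrite ltnNge; apply/negP=> dim1.
  have W2 : (#|finvect_type V| <= 2)%N.
    by rewrite card_finvect (@leq_exp2l 2 _ 1).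
  have N2 := leq_trans (leq_card (val : nonzero V -> finvect_type V) val_inj) W2.
  have := has_min_dist_le_length d5; rewrite card_sum => le5.
  by have := leq_trans le5 (leq_add N2 W2).
have dim_odd : odd (\dim {:V}) by rewrite dimV.
have [T [evenT sumT fT]] := even_set_with_sums dim_odd dim_gt1 f_apn f0 x 0.
have codeT : in_P f (punctured [set (x : finvect_type V)]) T.
  by rewrite in_P_punctured // !big_set1 evenT sumT fT addr0 !eqxx.
have := min_dist_move f0
  (B := [set (y : finvect_type V); (y + a : finvect_type V)])
  (E := [set (z : finvect_type V); (z + a : finvect_type V)]) d5 codeT.
rewrite -cards_eq0 !cards2 !(sum_set2 id) ?ne_translate //.
rewrite !sum_set2 ?ne_translate // !big_set1 !F2_add_cancel.
suff e : f (x + a) + f x = f y + f (y + a) + (f z + f (z + a)).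
  by move/(_ isT isT erefl e).
apply/eqP; rewrite -F2_addr_eq0.
(* Regroup the six terms as the two sides of the assumed equality. *)
rewrite [X in X == _](AC (2*(2*2)) ((2*3*5)*(1*4*6))).
by rewrite /= F2_addr_eq0 fxyz.
Qed.
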